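(* Let $\mathbf{K}$ be a monoidal triangulated category in which every thick right ideal is two-sided. Then every prime ideal of $\mathbf{K}$ is completely prime, and as a consequence, the universal support datum $V : \mathbf{K} \to \mathcal{X}(\operatorname{Spc} \mathbf{K})$ has the tensor product property $$V(A \otimes B) = V(A) \cap V(B) \quad \text{for all } A, B \in \mathbf{K}.$$
   Context: A monoidal triangulated category is a monoidal category $\mathbf{K}$ which is triangulated and for which $\otimes : \mathbf{K} \times \mathbf{K} \to \mathbf{K}$ is an exact bifunctor. A thick subcategory is a full triangulated subcategory containing all direct summands of its objects. A thick right ideal is a thick subcategory closed under right tensoring with arbitrary objects of $\mathbf{K}$; a thick two-sided ideal is a thick subcategory closed under left and right tensoring with arbitrary objects of $\mathbf{K}$. A prime ideal of $\mathbf{K}$ is a proper thick two-sided ideal $\mathbf{P}$ such that for all thick two-sided ideals $\mathbf{I}, \mathbf{J}$ of $\mathbf{K}$, $\mathbf{I} \otimes \mathbf{J} \subseteq \mathbf{P}$ implies $\mathbf{I} \subseteq \mathbf{P}$ or $\mathbf{J} \subseteq \mathbf{P}$, where $\mathbf{I}\otimes\mathbf{J}$ is the collection of objects $A \otimes B$ with $A\in\mathbf{I}$, $B\in\mathbf{J}$. (Equivalently: for all $A,B\in\mathbf{K}$, if $A \otimes C \otimes B \in \mathbf{P}$ for all $C \in \mathbf{K}$, then $A \in \mathbf{P}$ or $B \in \mathbf{P}$.) A proper thick two-sided ideal $\mathbf{P}$ is completely prime if for all objects $A, B$ of $\mathbf{K}$, $A \otimes B \in \mathbf{P}$ implies $A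 \in \mathbf{P}$ or $B \in \mathbf{P}$. The noncommutative Balmer spectrum $\operatorname{Spc} \mathbf{K}$ is the set of prime ideals of $\mathbf{K}$, with the topology generated by the closed sets $V(M) = \{ \mathbf{P} \in \operatorname{Spc} \mathbf{K} \mid M \notin \mathbf{P}\}$, $M \in \mathbf{K}$. The universal support datum is the map $M \mapsto V(M)$. $\mathcal{X}(Y)$ denotes the collection of all subsets of $Y$. *)

(* Defs.v *)
From HB Require Import structures.
From mathcomp Require Import all_boot all_order all_algebra.
From mathcomp Require Import boolp classical_sets topology.

Set Implicit Arguments.
Unset Strict Implicit.
Unset Printing Implicit Defensive.

Import GRing.Theory.
Local Open Scope classical_set_scope.
Local Open Scope ring_scope.

(* Hom groups are [zmodType]s; the choice structure that MathComp bundles into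
   [zmodType] is no restriction classically ([boolp.gen_choiceMixin]). *)
Record preadditive_category := PreadditiveCategory {
  obj :> Type;
  mor : obj -> obj -> zmodType;
  idm : forall X, mor X X;
  comp : forall X Y Z, mor Y Z -> mor X Y -> mor X Z;
  comp1m : forall X Y (f : mor X Y), comp (idm Y) f = f;
  compm1 : forall X Y (f : mor X Y), comp f (idm X) = f;
  compA : forall X Y Z W (h : mor Z W) (g : mor Y Z) (f : mor X Y),
    comp h (comp g f) = comp (comp h g) f;
  compDl : forall X Y Z (g g' : mor Y Z) (f : mor X Y),
    comp (g + g') f = comp g f + comp g' f;
  compDr : forall X Y Z (g : mor Y Z) (f f' : mor X Y),
    comp g (f + f') = comp g f + comp g f'
}.

Arguments mor {_} _ _.
Arguments idm {_} _.
Arguments comp {_ _ _ _} _ _.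

Notation "g ∘ f" := (comp g f) (at level 40, left associativity).

Definition is_iso (C : preadditive_category) (X Y : C) (f : mor X Y) : Prop :=
  exists g : mor Y X, g ∘ f = idm X /\ f ∘ g = idm Y.

Definition is_zero_obj (C : preadditive_category) (Z : C) : Prop :=
  forall X : C, (forall f : mor X Z, f = 0) /\ (forall f : mor Z X, f = 0).

Definition is_biproduct (C : preadditive_category) (X Y S : C) : Prop :=
  exists (i1 : mor X S) (i2 : mor Y S) (p1 : mor S X) (p2 : mor S Y),
    [/\ p1 ∘ i1 = idm X, p2 ∘ i2 = idm Y, p1 ∘ i2 = 0, p2 ∘ i1 = 0
      & i1 ∘ p1 + i2 ∘ p2 = idm S].

Record additive_category := AdditiveCategory {
  preadd :> preadditive_category;
  has_zero_obj : exists Z : preadd, is_zero_obj Z;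
  has_biproducts : forall X Y : preadd, exists S : preadd, is_biproduct X Y S
}.

Record functor (C D : preadditive_category) := Functor {
  fobj :> C -> D;
  fmor : forall X Y : C, mor X Y -> mor (fobj X) (fobj Y);
  fmor1 : forall X : C, fmor (idm X) = idm (fobj X);
  fmorM : forall (X Y Z : C) (g : mor Y Z) (f : mor X Y),
    fmor (g ∘ f) = fmor g ∘ fmor f
}.

Definition id_functor (C : preadditive_category) : functor C C :=
  @Functor C C (fun X => X) (fun X Y f => f)
    (fun _ => erefl) (fun _ _ _ _ _ => erefl).

Section CompFunctor.
Variables (C D E : preadditive_category) (G : functor D E) (F : functor C D).

Lemma comp_fmor1 (X : C) : fmor G (fmor F (idm X)) = idm (G (F X)).
Proof. by rewrite !fmor1. Qed.

Lemma comp_fmorM (X Y Z : C) (g : mor Y Z) (f : mor X Y) :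
  fmor G (fmor F (g ∘ f)) = fmor G (fmor F g) ∘ fmor G (fmor F f).
Proof. by rewrite !fmorM. Qed.

Definition comp_functor : functor C E :=
  @Functor C E (fun X => G (F X)) (fun X Y f => fmor G (fmor F f))
    comp_fmor1 comp_fmorM.
End CompFunctor.

Definition additive_functor (C D : preadditive_category) (F : functor C D) :
    Prop :=
  forall (X Y : C) (f g : mor X Y), fmor F (f + g) = fmor F f + fmor F g.

Definition nat_iso (C D : preadditive_category) (F G : functor C D)
    (phi : forall X : C, mor (F X) (G X)) : Prop :=
  (forall X : C, is_iso (phi X)) /\
  (forall (X Y : C) (f : mor X Y), fmor G f ∘ phi X = phi Y ∘ fmor F f).

Definition nat_isomorphic (C D : preadditive_category) (F G : functor C D) :
    Prop :=
  exists phi : forall X : C, mor (F X) (G X), nat_iso phi.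

Definition is_equivalence (C D : preadditive_category) (F : functor C D) :
    Prop :=
  exists G : functor D C,
    nat_isomorphic (comp_functor G F) (id_functor C) /\
    nat_isomorphic (comp_functor F G) (id_functor D).

(* [dist f g h] says that X -f-> Y -g-> Z -h-> shift X is distinguished. *)
Record triangulated_category := TriangulatedCategory {
  addcat :> additive_category;
  shift : functor addcat addcat;
  shift_additive : additive_functor shift;
  shift_equivalence : is_equivalence shift;
  dist : forall X Y Z : addcat,
    mor X Y -> mor Y Z -> mor Z (shift X) -> Prop;
  dist_iso : forall (X Y Z X' Y' Z' : addcat)
      (f : mor X Y) (g : mor Y Z) (h : mor Z (shift X))
      (f' : mor X' Y') (g' : mor Y' Z') (h' : mor Z' (shift X'))
      (a : mor X X') (b : mor Y Y') (c : mor Z Z'),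
    is_iso a -> is_iso b -> is_iso c ->
    b ∘ f = f' ∘ a -> c ∘ g = g' ∘ b -> fmor shift a ∘ h = h' ∘ c ->
    dist f g h -> dist f' g' h';
  dist_idm : forall X Z : addcat, is_zero_obj Z ->
    dist (idm X) (0 : mor X Z) (0 : mor Z (shift X));
  dist_cone : forall (X Y : addcat) (f : mor X Y),
    exists (Z : addcat) (g : mor Y Z) (h : mor Z (shift X)), dist f g h;
  dist_rotate : forall (X Y Z : addcat)
      (f : mor X Y) (g : mor Y Z) (h : mor Z (shift X)),
    dist f g h <-> dist g h (- fmor shift f);
  dist_fill : forall (X Y Z X' Y' Z' : addcat)
      (f : mor X Y) (g : mor Y Z) (h : mor Z (shift X))
      (f' : mor X' Y') (g' : mor Y' Z') (h' : mor Z' (shift X'))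
      (a : mor X X') (b : mor Y Y'),
    dist f g h -> dist f' g' h' -> b ∘ f = f' ∘ a ->
    exists c : mor Z Z', c ∘ g = g' ∘ b /\ fmor shift a ∘ h = h' ∘ c;
  dist_octahedron : forall (X Y Z X' Y' Z' : addcat)
      (f : mor X Y) (f' : mor Y Z') (f'' : mor Z' (shift X))
      (g : mor Y Z) (g' : mor Z X') (g'' : mor X' (shift Y))
      (h' : mor Z Y') (h'' : mor Y' (shift X)),
    dist f f' f'' -> dist g g' g'' -> dist (g ∘ f) h' h'' ->
    exists (u : mor Z' Y') (v : mor Y' X'),
      dist u v (fmor shift f' ∘ g'') /\
      [/\ u ∘ f' = h' ∘ g, v ∘ h' = g', h'' ∘ u = f''
        & g'' ∘ v = fmor shift f ∘ h'']
}.

Definition exact_functor (C D : triangulated_category) (F : functor C D) :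
    Prop :=
  additive_functor F /\
  exists phi : forall X : C, mor (F (shift C X)) (shift D (F X)),
    nat_iso (F := comp_functor F (shift C)) (G := comp_functor (shift D) F)
      phi /\
    forall (X Y Z : C) (f : mor X Y) (g : mor Y Z) (h : mor Z (shift C X)),
      dist f g h -> dist (fmor F f) (fmor F g) (phi X ∘ fmor F h).

Record monoidal_structure (C : preadditive_category) := MonoidalStructure {
  tens : C -> C -> C;
  tensm : forall A A' B B' : C,
    mor A A' -> mor B B' -> mor (tens A B) (tens A' B');
  tensm1 : forall A B : C, tensm (idm A) (idm B) = idm (tens A B);
  tensmM : forall (A A' A'' B B' B'' : C) (f' : mor A' A'') (f : mor A A')
      (g' : mor B' B'') (g : mor B B'),
    tensm (f' ∘ f) (g' ∘ g) = tensm f' g' ∘ tensm f g;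
  munit : C;
  assoc : forall A B D : C, mor (tens (tens A B) D) (tens A (tens B D));
  lunit : forall A : C, mor (tens munit A) A;
  runit : forall A : C, mor (tens A munit) A;
  assoc_iso : forall A B D : C, is_iso (assoc A B D);
  lunit_iso : forall A : C, is_iso (lunit A);
  runit_iso : forall A : C, is_iso (runit A);
  assoc_nat : forall (A A' B B' D D' : C)
      (f : mor A A') (g : mor B B') (h : mor D D'),
    tensm f (tensm g h) ∘ assoc A B D = assoc A' B' D' ∘ tensm (tensm f g) h;
  lunit_nat : forall (A A' : C) (f : mor A A'),
    f ∘ lunit A = lunit A' ∘ tensm (idm munit) f;
  runit_nat : forall (A A' : C) (f : mor A A'),
    f ∘ runit A = runit A' ∘ tensm f (idm munit);
  monoidal_pentagon : forall A B D E : C,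
    assoc A B (tens D E) ∘ assoc (tens A B) D E =
    tensm (idm A) (assoc B D E) ∘ assoc A (tens B D) E
      ∘ tensm (assoc A B D) (idm E);
  monoidal_triangle : forall A B : C,
    tensm (idm A) (lunit B) ∘ assoc A munit B = tensm (runit A) (idm B)
}.

Section TensorFunctors.
Variables (C : preadditive_category) (M : monoidal_structure C) (A : C).

Lemma tensm_idlM (X Y Z : C) (g : mor Y Z) (f : mor X Y) :
  tensm M (idm A) (g ∘ f) = tensm M (idm A) g ∘ tensm M (idm A) f.
Proof. by rewrite -tensmM comp1m. Qed.

Lemma tensm_idrM (X Y Z : C) (g : mor Y Z) (f : mor X Y) :
  tensm M (g ∘ f) (idm A) = tensm M g (idm A) ∘ tensm M f (idm A).
Proof. by rewrite -tensmM comp1m. Qed.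

Definition tensor_left : functor C C :=
  @Functor C C (fun X => tens M A X) (fun X Y f => tensm M (idm A) f)
    (fun X => tensm1 M A X) tensm_idlM.

Definition tensor_right : functor C C :=
  @Functor C C (fun X => tens M X A) (fun X Y f => tensm M f (idm A))
    (fun X => tensm1 M X A) tensm_idrM.
End TensorFunctors.

(* An exact bifunctor is a bifunctor that is exact in each variable. *)
Record monoidal_triangulated_category := MonoidalTriangulatedCategory {
  tricat :> triangulated_category;
  monoidal : monoidal_structure tricat;
  tensor_left_exact : forall A : tricat,
    exact_functor (tensor_left monoidal A : functor tricat tricat);
  tensor_right_exact : forall A : tricat,
    exact_functor (tensor_right monoidal A : functor tricat tricat)
}.

Definition tensor (K : monoidal_triangulated_category) (A B : K) : K :=
  tens (monoidal K) A B.

Notation "A ⊗ B" := (tensor A B) (at level 40, left associativity).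

(* A full subcategory is given by its class of objects. Closure under the
   inverse shift is the converse direction of the second clause. *)
Definition triangulated_subcategory (K : triangulated_category) (S : set K) :
    Prop :=
  [/\ (exists X : K, S X),
      (forall X Y : K, (exists f : mor X Y, is_iso f) -> S X -> S Y),
      (forall X : K, S (shift K X) <-> S X)
    & forall (X Y Z : K) (f : mor X Y) (g : mor Y Z) (h : mor Z (shift K X)),
        dist f g h -> S X -> S Y -> S Z].

Definition thick_subcategory (K : triangulated_category) (S : set K) : Prop :=
  triangulated_subcategory S /\
  forall X Y Z : K, is_biproduct X Y Z -> S Z -> S X.

Section Ideals.
Variable K : monoidal_triangulated_category.

Definition thick_right_ideal (I : set K) : Prop :=
  thick_subcategory I /\ forall A B : K, I A -> I (A ⊗ B).

Definition thick_two_sided_ideal (I : set K) : Prop :=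
  thick_subcategory I /\
  forall A B : K, I A -> I (A ⊗ B) /\ I (B ⊗ A).

Definition prime_ideal (P : set K) : Prop :=
  [/\ thick_two_sided_ideal P, P <> setT
    & forall I J : set K, thick_two_sided_ideal I -> thick_two_sided_ideal J ->
        [set A ⊗ B | A in I & B in J] `<=` P -> I `<=` P \/ J `<=` P].

Definition completely_prime_ideal (P : set K) : Prop :=
  [/\ thick_two_sided_ideal P, P <> setT
    & forall A B : K, P (A ⊗ B) -> P A \/ P B].

Definition Spc : Type := {P : set K | prime_ideal P}.

Definition V (M : K) : set Spc := [set P | ~ sval P M].
End Ideals.

HB.instance Definition _ (K : monoidal_triangulated_category) :=
  gen_eqMixin (Spc K).
HB.instance Definition _ (K : monoidal_triangulated_category) :=
  gen_choiceMixin (Spc K).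
(* The sets [V M] form a subbasis of closed sets. *)
HB.instance Definition _ (K : monoidal_triangulated_category) :=
  @isSubBaseTopological.Build (Spc K) (set (Spc K))
    [set ~` V M | M in [set: K]] id.

(* Main.v *)
Require Import Defs.
From mathcomp Require Import all_boot boolp classical_sets.
From mathcomp Require Import ssralg.
Local Open Scope classical_set_scope.

(** Let [P] be a two-sided thick ideal and [A] an object. The right annihilator
    [r(A) = {Y | A ⊗ Y ∈ P}] is a thick subcategory because it is the preimage
    of [P] under the exact functor [A ⊗ -] ([thick_preimage]), and it is a right
    ideal because [A ⊗ (Y ⊗ C) ≅ (A ⊗ Y) ⊗ C]. When right ideals are two-sided,
    [J = r(A)] is therefore a two-sided ideal; this is what allows an arbitrary
    object to be inserted between [A] and [B] once [A ⊗ B ∈ P].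

    Primeness is a condition on pairs of two-sided ideals, so [A] has to be put
    in a two-sided ideal annihilating [J] modulo [P]. The largest candidate is
    the left annihilator [I = {X | X ⊗ Y ∈ P for all Y ∈ J}]. It is thick as an
    intersection of preimages of [P] under the exact functors [- ⊗ Y], and it is
    two-sided because [J] is a left ideal and [P] is one
    ([left_annihilator_two_sided]). By construction [A ∈ I] and [I ⊗ J ⊆ P], and
    [B ∈ J] says exactly that [A ⊗ B ∈ P]. So [P] prime gives [A ∈ P] or
    [B ∈ P].

    For the supports, complete primeness of [P] yields
    [V(A) ∩ V(B) ⊆ V(A ⊗ B)], and the reverse inclusion holds because [P] is a
    two-sided ideal. *)

(** * Zero objects and additive functors *)

Section Preadditive.
Context {C : preadditive_category}.

Lemma comp0m {X Y Z : C} (f : mor X Y) : (0%R : mor Y Z) ∘ f = 0%R.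
Proof.
by apply: (@GRing.addrI _ ((0%R : mor Y Z) ∘ f)); rewrite -compDl !GRing.addr0.
Qed.

Lemma compm0 {X Y Z : C} (g : mor Y Z) : g ∘ (0%R : mor X Y) = 0%R.
Proof.
by apply: (@GRing.addrI _ (g ∘ (0%R : mor X Y))); rewrite -compDr !GRing.addr0.
Qed.

Lemma is_zero_objP (Z : C) : is_zero_obj Z <-> idm Z = 0%R.
Proof.
split=> [Z0|id0 X]; first exact: (Z0 Z).1.
by split=> f; [rewrite -(comp1m f) id0 comp0m | rewrite -(compm1 f) id0 compm0].
Qed.

Lemma biproduct_zero_l (Z X : C) : is_zero_obj Z -> is_biproduct Z X X.
Proof.
move=> /is_zero_objP Z0; exists 0%R, (idm X), 0%R, (idm X).
by split; rewrite ?comp1m ?comp0m ?GRing.add0r ?Z0.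
Qed.

Lemma is_iso_inv {X Y : C} :
  (exists f : mor X Y, is_iso f) -> exists g : mor Y X, is_iso g.
Proof. by move=> [f [g [gf fg]]]; exists g, f. Qed.

End Preadditive.

Section Functors.
Context {C D : preadditive_category} (F : functor C D).

Lemma functor_iso (X Y : C) :
  (exists f : mor X Y, is_iso f) -> exists f : mor (F X) (F Y), is_iso f.
Proof.
move=> [f [g [gf fg]]]; exists (fmor F f), (fmor F g).
by rewrite -!fmorM gf fg !fmor1.
Qed.

Context (addF : additive_functor F).

Lemma additive_functor0 (X Y : C) : fmor F (0%R : mor X Y) = 0%R.
Proof.
by apply: (@GRing.addrI _ (fmor F (0%R : mor X Y))); rewrite -addF !GRing.addr0.
Qed.

Lemma additive_functor_zero_obj (Z : C) : is_zero_obj Z -> is_zero_obj (F Z).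
Proof.
move=> /is_zero_objP Z0; apply/is_zero_objP.
by rewrite -fmor1 Z0 additive_functor0.
Qed.

Lemma additive_functor_biproduct (X Y S : C) :
  is_biproduct X Y S -> is_biproduct (F X) (F Y) (F S).
Proof.
move=> [i1 [i2 [p1 [p2 [e1 e2 e12 e21 e]]]]].
exists (fmor F i1), (fmor F i2), (fmor F p1), (fmor F p2).
by rewrite -!fmorM -addF e1 e2 e12 e21 e !fmor1 !additive_functor0.
Qed.

End Functors.

(** * Constructions of thick subcategories *)

Section Thick.
Context {K : triangulated_category}.

Lemma thick_iso (S : set K) (X Y : K) : thick_subcategory S ->
  (exists f : mor X Y, is_iso f) -> S X -> S Y.
Proof. by move=> [[_ isoS _ _] _]; exact: isoS. Qed.

(** A zero object is a direct summand of every object. *)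
Lemma thick_zero (S : set K) (Z : K) :
  thick_subcategory S -> is_zero_obj Z -> S Z.
Proof.
move=> [[[X SX] _ _ _] sumS] Z0.
exact: (sumS _ _ _ (biproduct_zero_l Z X Z0) SX).
Qed.

Lemma thick_bigcap (T : Type) (D : set T) (S : T -> set K) :
  (forall i, D i -> thick_subcategory (S i)) ->
  thick_subcategory (\bigcap_(i in D) S i).
Proof.
move=> thS; split; first split.
- (* Nonemptiness of each [S i] does not by itself give a common member; a zero
     object is one. *)
  by have [Z Z0] := has_zero_obj K; exists Z => i Di;
    exact: thick_zero (thS i Di) Z0.
- by move=> X Y isoXY SX i Di; exact: thick_iso (thS i Di) isoXY (SX i Di).
- by move=> X; split=> SX i Di; have [[_ _ shS _] _] := thS i Di;
    apply/shS; exact: SX.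
- move=> X Y Z f g h fgh SX SY i Di; have [[_ _ _ triS] _] := thS i Di.
  exact: triS fgh (SX i Di) (SY i Di).
- move=> X Y Z XYZ SZ i Di; have [_ sumS] := thS i Di.
  exact: sumS XYZ (SZ i Di).
Qed.

End Thick.

(** Closure of the preimage under shifts in both directions rests on
    [F (shift X) ≅ shift (F X)], so exactness enters twice: through this
    isomorphism and through the preservation of triangles. *)
Lemma thick_preimage (K L : triangulated_category) (F : functor K L)
    (S : set L) :
  exact_functor F -> thick_subcategory S -> thick_subcategory (F @^-1` S).
Proof.
move=> [addF [phi [[phi_iso _] distF]]] thS.
have [[_ _ shS triS] sumS] := thS.
split; first split.
- have [Z Z0] := has_zero_obj K; exists Z.
  exact: thick_zero thS (additive_functor_zero_obj F addF Z Z0).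
- by move=> X Y isoXY; apply: thick_iso thS _; exact: functor_iso.
- move=> X; have isoF : exists f : mor (F (shift K X)) (shift L (F X)), is_iso f.
    by exists (phi X); exact: phi_iso.
  split=> [SX|SX]; first by apply/shS; exact: thick_iso thS isoF SX.
  by apply: thick_iso thS (is_iso_inv isoF) _; apply/shS.
- by move=> X Y Z f g h /distF; exact: triS.
- by move=> X Y Z /(additive_functor_biproduct F addF); exact: sumS.
Qed.

(** * Annihilators modulo an ideal *)

Section Annihilators.
Context {K : monoidal_triangulated_category}.

Lemma tensor_assoc_mem (S : set K) (A B C : K) : thick_subcategory S ->
  S (A ⊗ B ⊗ C) <-> S (A ⊗ (B ⊗ C)).
Proof.
move=> thS; have isoA : exists f : mor (A ⊗ B ⊗ C) (A ⊗ (B ⊗ C)), is_iso f.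
  by exists (assoc (monoidal K) A B C); exact: assoc_iso.
by split; apply: thick_iso => //; exact: is_iso_inv.
Qed.

(** Only right ideals arise here: [A ⊗ (C ⊗ Y)] need not be related to
    [A ⊗ Y]. *)
Lemma right_annihilator_right_ideal (P : set K) (A : K) :
  thick_right_ideal P -> thick_right_ideal [set Y | P (A ⊗ Y)].
Proof.
move=> [thP idP]; split.
  exact: thick_preimage (tensor_left_exact A) thP.
by move=> Y C PAY; apply/tensor_assoc_mem => //; exact: idP.
Qed.

(** Stability of [J] under left tensoring is what makes [X ⊗ C] annihilate [J]
    when [X] does: [(X ⊗ C) ⊗ Y ≅ X ⊗ (C ⊗ Y)]. *)
Lemma left_annihilator_two_sided (P J : set K) :
  thick_two_sided_ideal P -> (forall C Y : K, J Y -> J (C ⊗ Y)) ->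
  thick_two_sided_ideal [set X | forall Y, J Y -> P (X ⊗ Y)].
Proof.
move=> [thP idP] leftJ; split.
  apply: (@thick_bigcap K K J (fun Y => [set X | P (X ⊗ Y)])) => Y _.
  exact: thick_preimage (tensor_right_exact Y) thP.
move=> X C annX; split=> Y JY; apply/tensor_assoc_mem => //.
- exact/annX/leftJ.
- by have [] := idP _ C (annX Y JY).
Qed.

Lemma two_sided_right_ideal (P : set K) :
  thick_two_sided_ideal P -> thick_right_ideal P.
Proof. by move=> [thP idP]; split=> // A B /(idP A B)[]. Qed.

End Annihilators.

(** * Prime ideals when right ideals are two-sided *)

Lemma prime_completely_prime (K : monoidal_triangulated_category)
    (P : set K) :
  (forall I : set K, thick_right_ideal I -> thick_two_sided_ideal I) ->
  prime_ideal P -> completely_prime_ideal P.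
Proof.
move=> right_two [idP properP primeP]; split=> // A B PAB.
pose J := [set Y | P (A ⊗ Y)].
pose I := [set X | forall Y, J Y -> P (X ⊗ Y)].
have idJ : thick_two_sided_ideal J.
  exact/right_two/right_annihilator_right_ideal/two_sided_right_ideal.
have idI : thick_two_sided_ideal I.
  by apply: left_annihilator_two_sided => // C Y /(idJ.2 Y C)[].
have IJ : [set X ⊗ Y | X in I & Y in J] `<=` P.
  by move=> _ [X IX [Y JY <-]]; exact: IX.
have [IP|JP] := primeP I J idI idJ IJ; last by right; exact: JP.
by left; apply: IP => Y.
Qed.

Theorem theorem3p2p1 (K : monoidal_triangulated_category)
    (right_ideals_two_sided : forall I : set K,
       thick_right_ideal I -> thick_two_sided_ideal I) :
  (forall P : set K, prime_ideal P -> completely_prime_ideal P) /\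
  (forall A B : K, V (A ⊗ B) = V A `&` V B).
Proof.
have cprime (P : set K) : prime_ideal P -> completely_prime_ideal P.
  exact: prime_completely_prime.
split=> // A B; apply/seteqP; split=> [[P primeP]|[P primeP]] /=.
- have [[_ idP] _ _] := primeP.
  move=> nAB; split=> [PA|PB]; apply: nAB.
    by have [] := idP A B PA.
  by have [] := idP B A PB.
- by move=> [nA nB] PAB; have [_ _ /(_ A B PAB)[]] := cprime P primeP.
Qed.
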